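(* Let $G$ be an oligomorphic closed subgroup of $S_\infty$. Then there is a neighbourhood basis at $1$, $V_0\supseteq V_1\supseteq V_2\supseteq \ldots\ni 1$, such that $$G\neq\bigcup_n F_nV_nE_n$$ for all finite subsets $F_n,E_n\subseteq G$ ($n\in\mathbb N$). Moreover, $G$ admits a continuous affine isometric action on a separable Banach space $X$ such that for some $\epsilon_n>0$ ($n\in \mathbb N$) and all sequences of compact subsets $C_n\subseteq X$ there is a $g\in G$ satisfying $$\mathrm{dist}(gC_n,C_n)>\epsilon_n$$ for all $n\in\mathbb N$.
   Context: $S_\infty$ is the Polish group of all permutations of the infinite discrete set $\mathbb N$ equipped with the topology of pointwise convergence. A closed subgroup $G\leqslant S_\infty$ is oligomorphic if, for every $n\geqslant 1$, $G$ induces only finitely many distinct orbits on $\mathbb N^n$. An action is continuous if the map $G\times X\to X$ is jointly continuous. For compact $A,B\subseteq X$, $\mathrm{dist}(A,B)=\inf\{\|a-b\| : a\in A,\ b\in B\}$. *)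

(* Defs.v *)
From HB Require Import structures.
From mathcomp Require Import all_boot all_order all_algebra.
From mathcomp Require Import all_classical all_reals all_analysis.
Import numFieldNormedType.Exports.

Set Implicit Arguments.
Unset Strict Implicit.
Unset Printing Implicit Defensive.

Import Order.TTheory GRing.Theory Num.Theory.

Local Open Scope classical_set_scope.
Local Open Scope ring_scope.

(* The inverse is part of the data, so that it need not be extracted from a
   bijectivity proof; it is determined by the function (lemma Sinf_ext). *)
Record Sinf := MkSinf {
  sfun :> nat -> nat;
  sfunV : nat -> nat;
  sfunK : cancel sfun sfunV;
  sfunVK : cancel sfunV sfun }.

Lemma Sinf_ext (g h : Sinf) : g =1 h -> g = h.
Proof.
case: g h => [f f' fK f'K] [k k' kK k'K] /= fk.
have {}fk : f = k by apply: funext.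
subst k; have {}kk : f' = k' by apply: funext => n; rewrite -{1}(k'K n) fK.
by subst k'; congr MkSinf; exact: Prop_irrelevance.
Qed.

HB.instance Definition _ := gen_eqMixin Sinf.
HB.instance Definition _ := gen_choiceMixin Sinf.

Definition Sinf1 : Sinf :=
  @MkSinf id id (fun n => erefl n) (fun n => erefl n).
Definition SinfM (g h : Sinf) : Sinf :=
  MkSinf (can_comp (sfunK g) (sfunK h)) (can_comp (sfunVK h) (sfunVK g)).
Definition SinfV (g : Sinf) : Sinf := MkSinf (sfunVK g) (sfunK g).

Lemma SinfMA : associative SinfM. Proof. by move=> f g h; exact: Sinf_ext. Qed.
Lemma Sinf1M : left_id Sinf1 SinfM. Proof. by move=> g; exact: Sinf_ext. Qed.
Lemma SinfM1 : right_id Sinf1 SinfM. Proof. by move=> g; exact: Sinf_ext. Qed.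
Lemma SinfVM : left_inverse Sinf1 SinfV SinfM.
Proof. by move=> g; apply: Sinf_ext => n; exact: sfunK. Qed.
Lemma SinfMV : right_inverse Sinf1 SinfV SinfM.
Proof. by move=> g; apply: Sinf_ext => n; exact: sfunVK. Qed.

HB.instance Definition _ :=
  isGroup.Build Sinf SinfMA Sinf1M SinfM1 SinfVM SinfMV.

(* Pointwise convergence: the topology induced by the product topology on
   nat -> nat, nat being discrete. *)
HB.instance Definition _ := Topological.copy Sinf
  (initial_topology (sfun : Sinf -> {ptws nat -> nat})).

Lemma nbhs_Sinf (g : Sinf) (U : set Sinf) :
  nbhs g U <-> exists N, forall h : Sinf, (forall i, (i < N)%N -> h i = g i) -> U h.
Proof.
pose B N := [set f : {ptws nat -> nat} | forall i, (i < N)%N -> f i = g i].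
split=> [[_ [[W oW <-] /= Wg WU]]|[N NU]].
  have FF : Filter (filter_from setT B).
    apply: filter_from_filter => [|i j _ _]; first by exists 0%N.
    exists (maxn i j) => // f Bf; split=> k kN; apply: Bf.
      exact: leq_trans kN (leq_maxl _ _).
    exact: leq_trans kN (leq_maxr _ _).
  have Fg : {ptws, filter_from setT B --> (g : nat -> nat)}.
    apply/pointwise_cvgP => t V /nbhs_singleton Vt.
    by exists t.+1 => // f /(_ t (ltnSn t)) /= ->.
  have [N _ BW] := Fg _ (open_nbhs_nbhs (conj oW Wg)).
  by exists N => h hN; apply: WU; exact: BW.
have ev i : \forall h \near g, sfun h i = g i.
  have ci : continuous (fun h : Sinf => h i : nat).
    move=> h; apply: (@continuous_comp _ {ptws nat -> nat} _ sfun (@^~ i)).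
      exact: initial_continuous.
    exact: (@proj_continuous nat (fun=> nat : topologicalType) i).
  by apply: (ci g [set g i]); rewrite nbhs_principalE; exact/principal_filterP.
suff : \forall h \near g, forall i, (i < N)%N -> sfun h i = g i.
  exact: filterS.
elim: N {NU} => [|N IH]; first by near=> h.
near=> h => i; rewrite ltnS leq_eqVlt => /orP[/eqP ->|].
  near: h; exact: ev.
move: i; near: h; exact: IH.
Unshelve. all: by end_near. Qed.

Definition orbit_tuple (G : set Sinf) (n : nat) (t : n.-tuple nat) :
  set (n.-tuple nat) := [set map_tuple g t | g in G].

Definition oligomorphic (G : set Sinf) :=
  forall n, (0 < n)%N ->
    finite_set [set orbit_tuple G t | t in [set: n.-tuple nat]].

Definition set_mulg (A B : set Sinf) : set Sinf :=
  [set (a * b)%g | a in A & b in B].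

(* The neighbourhood filter of 1 in the subspace topology of G is
   within G (nbhs 1); the sets V n are required to be subsets of G. *)
Definition nested_nbhs_basis1 (G : set Sinf) (V : nat -> set Sinf) :=
  [/\ forall n, V n `<=` G,
      forall n, V n.+1 `<=` V n,
      forall n, within G (nbhs (1%g : Sinf)) (V n) &
      forall U, within G (nbhs (1%g : Sinf)) U -> exists n, V n `<=` U].

Definition separable (T : topologicalType) :=
  exists2 D : set T, countable D & dense D.

(* An action of G on X is given by the restriction to G of a function on all
   of Sinf, whose values outside G are irrelevant. *)
Definition is_action (G : set Sinf) (X : Type) (act : Sinf -> X -> X) :=
  (forall x, act 1%g x = x) /\
  (forall g h, G g -> G h -> forall x, act (g * h)%g x = act g (act h x)).

Definition continuous_action (G : set Sinf) (X : topologicalType)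
    (act : Sinf -> X -> X) :=
  {within G `*` [set: X], continuous (fun p : Sinf * X => act p.1 p.2)}.

Definition affine_map (R : realType) (X : normedModType R) (f : X -> X) :=
  forall (t : R) (x y : X),
    f (t *: x + (1 - t) *: y) = t *: f x + (1 - t) *: f y.

Definition isometric_map (R : realType) (X : normedModType R) (f : X -> X) :=
  forall x y : X, `|f x - f y| = `|x - y|.

Definition continuous_affine_isometric_action (R : realType) (G : set Sinf)
    (X : normedModType R) (act : Sinf -> X -> X) :=
  [/\ is_action G act,
      continuous_action G act,
      forall g, G g -> affine_map (act g) &
      forall g, G g -> isometric_map (act g)].

(* Extended-real valued, so that the distance is +oo if A or B is empty. *)
Definition set_dist (R : realType) (X : normedModType R) (A B : set X) : \bar R :=
  ereal_inf [set (`|a - b|)%:E | a in A & b in B].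

(* Main.v *)
Require Import Defs.
From HB Require Import structures.
From mathcomp Require Import all_boot all_order all_algebra.
From mathcomp Require Import all_classical all_reals all_analysis.
From mathcomp Require Import ring lra.
Import numFieldNormedType.Exports.
Import Order.TTheory GRing.Theory Num.Theory.
Local Open Scope classical_set_scope.
Local Open Scope ring_scope.

Set Implicit Arguments.
Unset Strict Implicit.
Unset Printing Implicit Defensive.

(** Both assertions come from one combinatorial fact, [avoid_pairs]: there is
    an [n0], depending on [G] only, such that for any finite sets [S n] of pairs
    [(a, b)] of injective tuples of length [n0 + n], some [g] in [G] satisfies
    [g a <> b] for all these pairs simultaneously.

    Such a [g] is obtained by back and forth.  A stage consists of a finite
    algebraically closed set [D] (every point outside [D] has an infinite orbit
    under the pointwise stabiliser of [D]) and an element [h] of [G] of which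
    only the restriction to [D] is kept; the pairs [(a, b)] with [a] inside [D]
    are already avoided.  Oligomorphy enters through the finiteness of algebraic
    closures ([acl_exists]).  When [D] grows to a finite set [D'], only finitely
    many pairs become relevant, since a tuple of [n0 + n] distinct entries does
    not fit in [D'] for large [n].  Each newly relevant [a] has an entry with
    infinite orbit over [D], so Neumann's lemma ([neumann_separation]) corrects
    [h] by an element fixing [D] that moves all these entries away from the
    entries of the corresponding [b].  Replacing [h] by its inverse exchanges
    domain and range, and the limit lies in [G] because [G] is closed.

    For the first assertion, [V n] is the stabiliser of [0, ..., n0 + n - 1]: an
    element of [f (V n) e] maps the preimage by [e] of this tuple to its image
    by [f], so the union in question avoids the [g] provided by the fact.

    For the second assertion, [G] acts by translation on the summable functions
    on the countable set of finite sequences of integers.  The functions whose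
    sum over the injective sequences of length [n] equals [2^-n], for all [n],
    form a closed invariant affine subspace; taking one of them ([base]) as
    origin turns it into a Banach space [X] with an affine isometric action.
    For a compact set [C] and a given [n], the mass of the elements of [C] on
    the sequences of length [n] is concentrated, up to a small error, on one
    finite set [K] ([compact_block_mass]).  If [g] moves [K] off itself then
    [g C] and [C] carry almost disjoint masses there, of size almost [2^-n], and
    their distance is at least [2^-n / 2] ([compact_displacement]).  A single
    [g] moving all the finite sets [K] attached to the given compact sets off
    themselves exists by [avoid_pairs]. *)

(** * Permutation groups of the natural numbers *)

Definition is_subgroup (H : set Sinf) :=
  [/\ H 1%g, forall g h, H g -> H h -> H (g * h)%g
    & forall g, H g -> H (g^-1)%g].

Lemma is_subgroup_group_closed (G : set Sinf) :
  group_closed (mem G) -> is_subgroup G.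
Proof.
move=> grpG; have GV := group_closedV grpG; have GM := group_closedM grpG.
have G1 := proj1 grpG; split=> [|g h|g]; first by rewrite inE in G1.
  by move=> /mem_set gG /mem_set hG; exact/set_mem/GM.
by move=> /mem_set gG; exact/set_mem/GV.
Qed.

Lemma SinfME (g h : Sinf) x : (g * h)%g x = g (h x). Proof. by []. Qed.
Lemma SinfKV (g : Sinf) x : g^-1%g (g x) = x. Proof. exact: sfunK. Qed.
Lemma SinfVK (g : Sinf) x : g (g^-1%g x) = x. Proof. exact: sfunVK. Qed.
Lemma Sinf_inj (g : Sinf) : injective g. Proof. exact: can_inj (sfunK g). Qed.

Definition inf_orbit (H : set Sinf) (x : nat) :=
  forall B : seq nat, exists2 h, H h & h x \notin B.

Lemma not_inf_orbit H x :
  ~ inf_orbit H x <-> exists B : seq nat, forall h, H h -> h x \in B.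
Proof.
split=> [/existsNP[B nB]|[B HB] /(_ B) [h Hh]]; last by rewrite HB.
by exists B => h Hh; apply: contra_notT nB => hB; exists h.
Qed.

(** Neumann's separation lemma: finitely many points with infinite orbits can
    be moved off any given finite set simultaneously.  If adding a new point
    [a] to a movable list [l] destroyed movability, then, by pigeonhole, some
    fixed [c] would be hit by [a] while [l] is moved arbitrarily far away; as
    [c] is in the infinite orbit of [a], a second group element then moves [c]
    away, and [l] can be chosen beforehand to avoid the preimage of the
    target. *)
Lemma neumann_separation (H : set Sinf) (l : seq nat) : is_subgroup H ->
  {in l, forall x, inf_orbit H x} ->
  forall B : seq nat, exists2 h, H h & {in l, forall x, h x \notin B}.
Proof.
move=> [H1 HM HV]; elim: l => [|a l IH] infl B; first by exists 1%g.
have {}IH : forall B : seq nat, exists2 h, H h & {in l, forall x, h x \notin B}.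
  by apply: IH => x xl; apply: infl; rewrite inE xl orbT.
have infa : inf_orbit H a by apply: infl; rewrite mem_head.
have cons_avoid h : h a \notin B -> {in l, forall x, h x \notin B} ->
    {in a :: l, forall x, h x \notin B}.
  by move=> ha hl x; rewrite inE => /predU1P[->//|/hl].
have [[c [h0 Hh0 h0a] hc]|noc] := pselect (exists2 c,
    exists2 h0, H h0 & h0 a = c & forall B' : seq nat, exists2 h, H h &
    h a = c /\ {in l, forall x, h x \notin B'}).
  have [h' Hh' h'c] : exists2 h', H h' & h' c \notin B.
    have [k Hk kB] := infa B; exists (k * h0^-1)%g; first exact/HM/HV.
    by rewrite SinfME -h0a SinfKV.
  have [h Hh [ha hl]] := hc [seq h'^-1%g b | b <- B].
  exists (h' * h)%g; first exact: HM.
  apply: cons_avoid => [|x xl]; first by rewrite SinfME ha.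
  by apply: contra (hl x xl) => hxB; rewrite -[h x](SinfKV h') map_f.
(* A finite set of values of [a] is then excluded by moving [l] far enough. *)
have /choice[A AP] : forall c, exists A : seq nat, forall h, H h ->
    h a = c -> ~ {in l, forall x, h x \notin A}.
  move=> c; apply: contrapT => /forallNP nA; apply: noc.
  have wit (B' : seq nat) : exists2 h, H h & h a = c /\ {in l, forall x, h x \notin B'}.
    have /existsNP[h /not_implyP[Hh /not_implyP[ha /contrapT hl]]] := nA B'.
    by exists h.
  by exists c => //; have [h Hh [ha _]] := wit [::]; exists h.
have [h Hh hl] := IH (B ++ flatten [seq A c | c <- B]).
exists h => //; apply: cons_avoid => [|x xl].
  apply/negP => haB; apply: (AP (h a) h Hh erefl) => x xl.
  apply: contra (hl x xl) => hxA; rewrite mem_cat; apply/orP; right.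
  by apply/flattenP; exists (A (h a)) => //; exact: map_f.
by apply: contra (hl x xl); rewrite mem_cat => ->.
Qed.

Definition stabiliser (H : set Sinf) (D : seq nat) : set Sinf :=
  [set g | H g /\ {in D, g =1 id}].

Lemma stabiliser_subgroup H D : is_subgroup H -> is_subgroup (stabiliser H D).
Proof.
move=> [H1 HM HV]; split=> [|g h [Hg gD] [Hh hD]|g [Hg gD]].
- by split=> // x.
- by split=> [|x xD]; [exact: HM | rewrite SinfME hD// gD].
- by split=> [|x xD]; [exact: HV | rewrite -{1}(gD x xD) SinfKV].
Qed.

(** The stabiliser of a point [y] with finite orbit has finite index: if the
    orbit of [x] under it were finite, finitely many translates of that orbit
    would cover the orbit of [x] under [H]. *)
Lemma inf_orbit_stabiliser1 H x y : is_subgroup H ->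
  ~ inf_orbit H y -> inf_orbit H x -> inf_orbit (stabiliser H [:: y]) x.
Proof.
move=> [H1 HM HV] /not_inf_orbit[Y HY] infx; apply: contrapT.
move=> /not_inf_orbit[B HB].
have /choice[t tP] : forall b, exists t, (exists2 g, H g & g y = b) ->
    H t /\ t y = b.
  move=> b; have [[g Hg gy]|nb] := pselect (exists2 g, H g & g y = b).
    by exists g.
  by exists 1%g.
have [g Hg /negP[]] := infx (flatten [seq [seq t b i | i <- B] | b <- Y]).
have [Ht ty] := tP (g y) (ex_intro2 _ _ g Hg erefl).
apply/flattenP; exists [seq t (g y) i | i <- B].
  by rewrite (map_f (fun b => [seq t b i | i <- B])) ?HY.
rewrite -[g x](SinfVK (t (g y))) map_f// (HB ((t (g y))^-1 * g)%g)//.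
split; first exact/HM/Hg/HV.
by move=> z; rewrite inE => /eqP ->; rewrite SinfME -{2}ty SinfKV.
Qed.

Lemma inf_orbit_stabiliser H x E : is_subgroup H ->
  {in E, forall y, ~ inf_orbit H y} -> inf_orbit H x ->
  inf_orbit (stabiliser H E) x.
Proof.
elim: E H => [|y E IH] H sH finE infx.
  by move=> B; have [h Hh hx] := infx B; exists h.
have sub g : stabiliser H [:: y] g -> H g by case.
have := IH _ (stabiliser_subgroup [:: y] sH).
have finy : ~ inf_orbit H y by apply: finE; rewrite mem_head.
move=> /(_ _ (inf_orbit_stabiliser1 sH finy infx)) infx' B.
have [z zE infz|h [[Hh hy] hE] hx] := infx' _ B.
  apply: (finE z); first by rewrite inE zE orbT.
  by move=> B'; have [h /sub Hh hz] := infz B'; exists h.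
exists h => //; split=> // z; rewrite inE => /predU1P[->|/hE//].
by rewrite hy// mem_head.
Qed.

(** * Algebraic closure in an oligomorphic group *)

Section Oligomorphic.
Variable G : set Sinf.
Hypothesis sG : is_subgroup G.
Hypothesis oligoG : oligomorphic G.

Let G1 : G 1%g. Proof. by case: sG. Qed.
Let GM g h : G g -> G h -> G (g * h)%g. Proof. by case: sG => _ + _; exact. Qed.
Let GV g : G g -> G g^-1%g. Proof. by case: sG => _ _; exact. Qed.

(** Oligomorphy is used through finite lists of orbit representatives; plain
    sequences avoid casts between tuple types. *)
Lemma oligomorphic_reps k : exists L : seq (seq nat), forall t : seq nat,
  size t = k.+1 -> exists2 l, l \in L & exists2 g, G g & map g l = t.
Proof.
pose rep (o : set (k.+1.-tuple nat)) : seq nat :=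
  if pselect (exists t, o = orbit_tuple G t) is left e then val (projT1 (cid e))
  else [::].
have /finite_seqP[L LE] := finite_image rep (oligoG (ltn0Sn k)).
exists L => t /eqP st; pose u := Tuple st.
have uL : rep (orbit_tuple G u) \in L.
  suff : [set` L] (rep (orbit_tuple G u)) by [].
  by rewrite -LE; exists (orbit_tuple G u) => //; exists u.
exists (rep (orbit_tuple G u)) => //; rewrite /rep; case: pselect => [e|]; last first.
  by case; exists u.
case: (cid e) => /= v uv.
have : orbit_tuple G u u.
  by exists 1%g => //; apply: val_inj; rewrite /= map_id.
by rewrite uv => -[g Gg /(congr1 val)/= gv]; exists g.
Qed.

(** Orbits of the stabiliser of [D] on points correspond to orbits of [G] on
    the tuples that extend [D] by one entry. *)
Lemma stabiliser_reps D : exists L : seq nat, forall x,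
  exists2 l, l \in L & exists2 g, stabiliser G D g & g l = x.
Proof.
have [L LP] := oligomorphic_reps (size D).
have /choice[r rP] : forall l, exists r : nat,
    (exists x, exists2 g, G g & map g l = rcons D x) ->
    exists2 g, G g & map g l = rcons D r.
  move=> l.
  have [[x xP]|n] := pselect (exists x, exists2 g, G g & map g l = rcons D x).
    by exists x.
  by exists 0%N.
exists (map r L) => x; have [l lL [g Gg gl]] := LP _ (size_rcons D x).
have [|h Gh hl] := rP l; first by exists x; exists g.
exists (r l); first exact: map_f.
have : map (g * h^-1)%g (rcons D (r l)) = rcons D x.
  by rewrite -gl -hl -map_comp; apply: eq_map => z; by have -> : g z = g (h^-1%g (h z)) by rewrite SinfKV.
rewrite map_rcons => /rcons_inj[gD gx]; exists (g * h^-1)%g => //.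
split; first exact/GM/GV.
by apply/eq_in_map; rewrite map_id.
Qed.

(** The stabiliser of [D] has finitely many orbits on the integers, hence the
    union of its finite orbits, the algebraic closure of [D], is finite. *)
Lemma acl_finite D : exists D' : seq nat,
  forall y, y \in D' <-> ~ inf_orbit (stabiliser G D) y.
Proof.
have [L LP] := stabiliser_reps D.
have /choice[S SP] : forall l, exists S : seq nat,
    ~ inf_orbit (stabiliser G D) l ->
    forall h, stabiliser G D h -> h l \in S.
  move=> l; have [/not_inf_orbit[S SP]|nl] :=
    pselect (~ inf_orbit (stabiliser G D) l); first by exists S.
  by exists [::].
exists [seq y <- flatten (map S L) | `[< ~ inf_orbit (stabiliser G D) y >]].
move=> y; rewrite mem_filter; split=> [/andP[/asboolP]//|finy].
apply/andP; split; first exact/asboolP.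
have [l lL [g Dg gl]] := LP y; apply/flattenP; exists (S l); first exact: map_f.
rewrite -gl; apply: SP => // infl; apply: finy => B.
have [h Dh hl] := infl B; exists (h * g^-1)%g; last by rewrite SinfME -gl SinfKV.
by case: (stabiliser_subgroup D sG) => _ M V; exact/M/V.
Qed.

Definition alg_closed (D : seq nat) :=
  forall x, x \notin D -> inf_orbit (stabiliser G D) x.

(** Algebraic closure is idempotent: by [inf_orbit_stabiliser], fixing finitely
    many further points of finite orbit does not make an infinite orbit
    finite. *)
Lemma acl_exists (D : seq nat) : exists2 D' : seq nat, {subset D <= D'} & alg_closed D'.
Proof.
have [D' D'P] := acl_finite D.
have DD' : {subset D <= D'}.
  move=> x xD; apply/D'P; apply/not_inf_orbit; exists [:: x] => h [_ hD].
  by rewrite inE hD.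
exists D' => // x xD'.
have infx : inf_orbit (stabiliser G D) x.
  by apply: contrapT => /D'P; exact/negP.
have finD' : {in D', forall y, ~ inf_orbit (stabiliser G D) y}.
  by move=> y /D'P.
move=> B.
have := inf_orbit_stabiliser (stabiliser_subgroup D sG) finD' infx.
by move=> /(_ B) [h [[Gh _] hD'] hx]; exists h.
Qed.

Lemma alg_closed_map D g : G g -> alg_closed D -> alg_closed (map g D).
Proof.
move=> Gg clD x xD B.
have xgD : g^-1%g x \notin D.
  by apply: contra xD => xD; rewrite -[x](SinfVK g) map_f.
have [h [Gh hD] hx] := clD _ xgD (map g^-1%g B).
exists (g * h * g^-1)%g.
  split; first by apply: GM; [exact: GM | exact: GV].
  by move=> _ /mapP[z zD ->]; rewrite !SinfME SinfKV hD.
rewrite !SinfME; apply: contra hx => hx.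
by rewrite -[h _](SinfKV g) map_f.
Qed.

(** * Elements of an oligomorphic group avoiding prescribed values *)

(** The pairs [(a, b)] listed by [S] are forbidden transitions: the element
    sought must not map [a] to [b].  The growth of the lengths makes only
    finitely many of them relevant to a given finite set. *)
Definition growing_tuples (S : nat -> seq (seq nat * seq nat)) :=
  forall n p, p \in S n ->
    [/\ uniq p.1, uniq p.2, (n <= size p.1)%N & (n <= size p.2)%N].

(** Only the restriction of [h] to [D] matters: the values of [h] on [D] are
    never changed later on. *)
Definition partial_solution (S : nat -> seq (seq nat * seq nat))
    (D : seq nat) (h : Sinf) :=
  [/\ G h, alg_closed D & forall n p, p \in S n ->
    {subset p.1 <= D} -> map h p.1 <> p.2].

Definition swap_pairs (S : nat -> seq (seq nat * seq nat)) n :=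
  [seq (p.2, p.1) | p <- S n].

Lemma growing_swap_pairs S : growing_tuples S -> growing_tuples (swap_pairs S).
Proof. by move=> gS n _ /mapP[p /gS[u1 u2 s1 s2] ->]. Qed.

Lemma swap_pairsK S : swap_pairs (swap_pairs S) =1 S.
Proof.
by move=> n; rewrite /swap_pairs -map_comp -[RHS]map_id; apply: eq_map => -[].
Qed.

(** Inversion exchanges domain and range, and with them the two entries of each
    forbidden pair. *)
Lemma partial_solution_inv S D h : partial_solution S D h ->
  partial_solution (swap_pairs S) (map h D) h^-1%g.
Proof.
move=> [Gh clD hS]; split; [exact: GV | exact: alg_closed_map |].
move=> n _ /mapP[p pS ->] /= pD hp.
have ph : map h p.1 = p.2.
  by rewrite -hp -map_comp -[RHS]map_id; apply: eq_map => x; exact: sfunVK.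
apply: (hS n p) => // x xp; have : h x \in p.2 by rewrite -ph map_f.
by move=> /pD /mapP[y yD /Sinf_inj ->].
Qed.

(** A finite set contains the distinct entries of only finitely many of the
    growing tuples.  So only finitely many pairs matter on the closure [D'] of
    [x :: D]; those not inside [D] have an entry with infinite orbit over [D],
    and the separation lemma applied to the stabiliser of [D] handles all of
    them at once. *)
Lemma extend_domain S D h x : growing_tuples S -> partial_solution S D h ->
  exists D' h', [/\ partial_solution S D' h', {subset x :: D <= D'}
    & {in D, h' =1 h}].
Proof.
move=> gS [Gh clD hS]; have [D' DD' clD'] := acl_exists (x :: D).
pose relevant := flatten [seq S n | n <- iota 0 (size D').+1].
pose B := flatten [seq map h^-1%g p.2 | p <- relevant].
pose A := [seq y <- D' | y \notin D].
have [||w [Gw wD] wA] := @neumann_separation (stabiliser G D) A _ _ B.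
- exact: stabiliser_subgroup.
- by move=> y; rewrite mem_filter => /andP[/clD].
exists D', (h * w)%g; split=> //; last first.
  by move=> y yD; rewrite SinfME wD.
split=> //; first exact: GM.
move=> n p pS pD'.
have [pD|] := pselect {subset p.1 <= D}.
  rewrite (_ : map _ _ = map h p.1); first exact: hS pS pD.
  by apply/eq_in_map => y /pD yD; rewrite SinfME wD.
move=> /existsNP[y /not_implyP[yp /negP yD]] hwp.
have [u1 _ s1 _] := gS n p pS.
have nD' : (n <= size D')%N by exact: leq_trans s1 (uniq_leq_size u1 pD').
have /negP[] : w y \notin B by apply: wA; rewrite mem_filter yD pD'.
apply/flattenP; exists (map h^-1%g p.2).
  apply: (map_f (fun p => map h^-1%g p.2)); apply/flattenP.
  by exists (S n) => //; apply: map_f; rewrite mem_iota add0n ltnS.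
by rewrite -[w y](SinfKV h) map_f// -SinfME -hwp map_f.
Qed.

(** The range is extended by extending the domain of the inverse. *)
Lemma extend_range S D h y : growing_tuples S -> partial_solution S D h ->
  exists D' h', [/\ partial_solution S D' h', {subset D <= D'},
    {in D, h' =1 h} & y \in map h' D'].
Proof.
move=> gS /partial_solution_inv sol.
have [E [k [solE DE kD]]] := extend_domain y (growing_swap_pairs gS) sol.
have hk x : x \in D -> k (h x) = x by move=> xD; rewrite kD ?map_f// SinfKV.
exists (map k E), k^-1%g; split.
- have [Gk clk kS] := partial_solution_inv solE; split=> // n p pS.
  by apply: (kS n); rewrite swap_pairsK.
- by move=> x xD; rewrite -(hk x xD) map_f// DE// inE map_f ?orbT.
- by move=> x xD; rewrite -{1}(hk x xD) SinfKV.
- rewrite -map_comp (eq_map (g := id)) ?map_id; first by rewrite DE ?mem_head.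
  by move=> z; exact: sfunK.
Qed.

(** As the values on [D k] are stable from stage [k] on, and every integer
    enters both the domains and the ranges, the [h k] and their inverses
    converge pointwise. *)
Lemma partial_solution_limit (D : nat -> seq nat) (h : nat -> Sinf) :
  closed G -> (forall k, G (h k)) ->
  (forall k, {subset D k <= D k.+1}) -> (forall k, {in D k, h k.+1 =1 h k}) ->
  (forall k, k \in D k.+1) -> (forall k, k \in map (h k.+1) (D k.+1)) ->
  exists2 g, G g & forall k, {in D k, g =1 h k}.
Proof.
move=> clG Gh DS hS Dk hDk.
have Dle i j : (i <= j)%N -> {subset D i <= D j} /\ {in D i, h j =1 h i}.
  move=> /subnK <-; elim: (j - i)%N => [|d [IH1 IH2]]; first by split.
  by split=> x xD; [exact/DS/IH1 | rewrite addSn hS ?IH2// IH1].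
pose g x := h x.+1 x; pose gV y := (h y.+1)^-1%g y.
have gE k : {in D k, g =1 h k}.
  move=> x xD; rewrite /g; have [xk|/ltnW kx] := leqP x.+1 k.
    by rewrite (Dle _ _ xk).2.
  by rewrite (Dle _ _ kx).2.
have gVE k y : (y < k)%N -> gV y = (h k)^-1%g y.
  move=> /Dle[_ hk]; have /mapP[x xD yx] := hDk y.
  have -> : gV y = x by exact: (canLR (sfunK (h y.+1)) yx).
  by apply/esym/(canLR (sfunK (h k))); rewrite hk.
have gE' k x : (x < k)%N -> g x = h k x.
  by move=> xk; rewrite (gE k)// (Dle x.+1 k xk).1.
have gK : cancel g gV.
  move=> x; pose k := maxn x.+1 (g x).+1.
  rewrite (gVE k) ?leq_maxr// (gE' k) ?leq_maxl// ?SinfKV//.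
have gVK : cancel gV g.
  move=> y; pose k := maxn y.+1 (gV y).+1.
  by rewrite (gE' k) ?leq_maxr// (gVE k) ?leq_maxl// ?SinfVK//.
exists (MkSinf gK gVK) => //.
apply: clG => U /nbhs_Sinf[n nU]; exists (h n); split=> //.
by apply: nU => i iN /=; rewrite (gE' n).
Qed.

(** Alternately enlarging domain and range exhausts the integers.  The
    construction starts with the identity on the closure [D0] of the empty set,
    where no pair is relevant yet: a tuple of more than [size D0] distinct
    entries does not fit in [D0], whence the choice of [n0]. *)
Lemma avoid_pairs : closed G -> exists n0 : nat, forall S : nat -> seq (seq nat * seq nat),
  (forall n p, p \in S n ->
    [/\ uniq p.1, uniq p.2, size p.1 = (n0 + n)%N & size p.2 = (n0 + n)%N]) ->
  exists2 g, G g & forall n p, p \in S n -> map g p.1 <> p.2.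
Proof.
move=> clG; have [D0 _ clD0] := acl_exists [::].
exists (size D0).+1 => S Ssize.
have gS : growing_tuples S.
  by move=> n p /Ssize[u1 u2 -> ->]; split=> //; rewrite leq_addl.
pose sol (s : seq nat * Sinf) := partial_solution S s.1 s.2.
have sol0 : sol (D0, 1%g).
  split=> // n p /Ssize[u1 _ s1 _] /(uniq_leq_size u1).
  by rewrite s1 addSn ltnNge leq_addr.
pose extends k (s s' : seq nat * Sinf) :=
  [/\ {subset s.1 <= s'.1}, {in s.1, s'.2 =1 s.2}, k \in s'.1
    & k \in map s'.2 s'.1].
have /choice[F FP] : forall ks : nat * (seq nat * Sinf), exists s',
    sol ks.2 -> sol s' /\ extends ks.1 ks.2 s'.
  move=> [k [D h]]; have [solD|] := pselect (sol (D, h)); last by exists (D, h).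
  have [D1 [h1 [sol1 DD1 hh1]]] := extend_domain k gS solD.
  have [D2 [h2 [sol2 DD2 hh2 kD2]]] := extend_range k gS sol1.
  exists (D2, h2) => _; split=> //; split=> //=.
  - by move=> x xD; apply/DD2/DD1; rewrite inE xD orbT.
  - by move=> x xD; rewrite hh2 ?hh1// DD1// inE xD orbT.
  - by apply/DD2/DD1; rewrite mem_head.
pose s := fix s k := if k is k'.+1 then F (k', s k') else (D0, 1%g).
have sol_s k : sol (s k) by elim: k => //= k /(FP (k, s k))[].
have ext_s k : extends k (s k) (s k.+1) by have [] := FP (k, s k) (sol_s k).
have [k|k|k|k|k|g Gg gs] :=
  @partial_solution_limit (fun k => (s k).1) (fun k => (s k).2) clG.
- by case: (sol_s k).
- by case: (ext_s k).
- by case: (ext_s k).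
- by case: (ext_s k).
- by case: (ext_s k).
exists g => // n p pS.
have [k pk] : exists k, {subset p.1 <= (s k).1}.
  have sub i j : (i <= j)%N -> {subset (s i).1 <= (s j).1}.
    move=> /subnK <-; elim: (j - i)%N => [//|d IH] x /IH xs.
    by case: (ext_s (d + i)%N) => + _ _ _; exact.
  exists (\max_(x <- p.1) x.+1) => x xp.
  apply: (sub x.+1); last by case: (ext_s x).
  exact: (@leq_bigmax_seq _ p.1 xpredT succn x).
have [_ _ /(_ n p pS pk)] := sol_s k.
by rewrite (_ : map g _ = map (s k).2 p.1)//; apply/eq_in_map => x /pk /gs.
Qed.

End Oligomorphic.

(** * Absolutely summable functions with vanishing block sums *)

Section Summable.
Variables (R : realType) (I : countType).
Implicit Types (f g : I -> R) (M : R) (B K : seq I).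

Definition l1_le f M := forall B, uniq B -> \sum_(i <- B) `|f i| <= M.
Definition l1_fun f := exists M, l1_le f M.
Definition l1norm f := sup [set \sum_(i <- B) `|f i| | B in [set B | uniq B]].

Lemma l1_le_abs f g M : (forall i, `|f i| <= `|g i|) -> l1_le g M -> l1_le f M.
Proof. by move=> fg gM B /gM; apply: le_trans; exact: ler_sum. Qed.

Lemma l1_leW f M N : M <= N -> l1_le f M -> l1_le f N.
Proof. by move=> MN fM B /fM /le_trans; exact. Qed.

Lemma l1_leD f g M N : l1_le f M -> l1_le g N ->
  l1_le (fun i => f i + g i) (M + N).
Proof.
move=> fM gN B uB; apply: le_trans (lerD (fM B uB) (gN B uB)).
by rewrite -big_split/=; apply: ler_sum => i _; exact: ler_normD.
Qed.

Lemma l1_leN f M : l1_le f M -> l1_le (fun i => - f i) M.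
Proof. by apply: l1_le_abs => i; rewrite normrN. Qed.

Lemma l1_leB f g M N : l1_le f M -> l1_le g N ->
  l1_le (fun i => f i - g i) (M + N).
Proof. by move=> fM /l1_leN; exact: l1_leD. Qed.

Lemma l1_leZ a f M : l1_le f M -> l1_le (fun i => a * f i) (`|a| * M).
Proof.
move=> fM B /fM fB; under eq_bigr do rewrite normrM.
by rewrite -mulr_sumr ler_wpM2l.
Qed.

Lemma l1_le_comp f M (s : I -> I) : injective s -> l1_le f M ->
  l1_le (fun i => f (s i)) M.
Proof.
by move=> sI fM B uB; rewrite -(big_map s xpredT (fun i => `|f i|)) fM// map_inj_uniq.
Qed.

Lemma l1norm_has_sup f : l1_fun f ->
  has_sup [set \sum_(i <- B) `|f i| | B in [set B | uniq B]].
Proof.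
move=> [M fM]; split; first by exists 0, [::] => //; rewrite big_nil.
by exists M => _ [B uB <-]; exact: fM.
Qed.

Lemma l1_le_norm f : l1_fun f -> l1_le f (l1norm f).
Proof. by move=> /l1norm_has_sup fM B uB; apply: sup_upper_bound => //; exists B. Qed.

Lemma l1norm_le f M : l1_le f M -> l1norm f <= M.
Proof.
move=> fM; apply: ge_sup; first by exists 0, [::] => //; rewrite big_nil.
by move=> _ [B uB <-]; exact: fM.
Qed.

Lemma l1_le_eq0 f : l1_le f 0 -> forall i, f i = 0.
Proof.
move=> f0 i; have := f0 [:: i] isT.
by rewrite big_seq1 normr_le0 => /eqP.
Qed.

(** A finite set on which the sum is within [e] of the supremum leaves at most
    [e] for all the sets disjoint from it. *)
Lemma l1_tail f e : l1_fun f -> 0 < e -> exists2 K, uniq K &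
  forall B, uniq B -> {in B, forall i, i \notin K} -> \sum_(i <- B) `|f i| <= e.
Proof.
move=> ff e0; have [_ [K uK <-] Ke] := sup_adherent e0 (l1norm_has_sup ff).
exists K => // B uB BK.
have : \sum_(i <- K ++ B) `|f i| <= l1norm f.
  apply: l1_le_norm => //; rewrite cat_uniq uK uB andbT /=.
  by apply/hasPn => i /BK.
by rewrite big_cat/=; rewrite /l1norm in Ke *; lra.
Qed.

(** The vanishing of the unconditional sum of [f] over [P]: the limit is taken
    along the directed set of finite subsets of [I]. *)
Definition null_sum (P : pred I) f := forall e : R, 0 < e ->
  exists A : seq I, forall B, uniq B -> {subset A <= B} ->
    `|\sum_(i <- B | P i) f i| <= e.

Lemma null_sum0 P : null_sum P (fun=> 0).
Proof. by move=> e e0; exists [::] => B _ _; rewrite big1// normr0 ltW. Qed.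

Lemma null_sum_lin P a f g : null_sum P f -> null_sum P g ->
  null_sum P (fun i => a * f i + g i).
Proof.
move=> f0 g0 e e0; have ae0 : 0 < e / (2 * (`|a| + 1)).
  by rewrite divr_gt0// mulr_gt0// ltr_pwDr.
have e20 : 0 < e / 2 by rewrite divr_gt0.
have [A1 fA1] := f0 _ ae0; have [A2 gA2] := g0 _ e20.
exists (A1 ++ A2) => B uB AB.
rewrite big_split/= -mulr_sumr (le_trans (ler_normD _ _))//.
rewrite [leRHS]splitr lerD//; last first.
  by apply: gA2 => // i iA; apply: AB; rewrite mem_cat iA orbT.
have /(ler_wpM2l (normr_ge0 a)) : `|\sum_(i <- B | P i) f i| <= e / (2 * (`|a| + 1)).
  by apply: fA1 => // i iA; apply: AB; rewrite mem_cat iA.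
rewrite -normrM => /le_trans; apply.
have a1 : 0 < `|a| + 1 by rewrite ltr_pwDr.
rewrite mulrA ler_pdivrMr ?mulr_gt0//; have := mulr_ge0 (normr_ge0 a) (ltW e0); nra.
Qed.

(** On each finite set the sums of [f] and of a close [g] are close, so the
    condition passes to limits in norm; this makes the space below complete. *)
Lemma null_sum_approx P f :
  (forall e, 0 < e -> exists2 g, null_sum P g & l1_le (fun i => f i - g i) e) ->
  null_sum P f.
Proof.
move=> fapp e e0; have e20 : 0 < e / 2 by rewrite divr_gt0.
have [g g0 fg] := fapp _ e20; have [A gA] := g0 _ e20.
exists A => B uB AB; rewrite [leRHS]splitr.
have -> : \sum_(i <- B | P i) f i =
    \sum_(i <- B | P i) (f i - g i) + \sum_(i <- B | P i) g i.
  by rewrite -big_split/=; apply: eq_bigr => i _; rewrite subrK.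
rewrite (le_trans (ler_normD _ _))// lerD ?gA//.
rewrite -big_filter (le_trans (ler_norm_sum _ _ _))// fg// filter_uniq//.
Qed.

Lemma null_sum_comp P f (s t : I -> I) : cancel s t -> cancel t s ->
  (forall i, P (s i) = P i) -> null_sum P f -> null_sum P (fun i => f (s i)).
Proof.
move=> sK tK Ps f0 e e0; have [A fA] := f0 e e0; exists (map t A) => B uB AB.
have -> : \sum_(i <- B | P i) f (s i) = \sum_(i <- map s B | P i) f i.
  by rewrite big_map; apply: eq_bigl => i; rewrite Ps.
apply: fA; first by rewrite map_inj_uniq//; exact: can_inj sK.
by move=> i iA; rewrite -[i]tK map_f// AB// map_f.
Qed.

End Summable.

(** * The Banach space *)

Section Space.
Variables (R : realType) (I : countType) (P : nat -> pred I).

Definition l1_null_pred : {pred I -> R} :=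
  [pred f | `[< l1_fun f /\ forall n, null_sum (P n) f >]].

Lemma l1_null_predP f :
  reflect (l1_fun f /\ forall n, null_sum (P n) f) (f \in l1_null_pred).
Proof. exact: asboolP. Qed.

Lemma l1_null_submod_closed : submod_closed l1_null_pred.
Proof.
split=> [|a f g /l1_null_predP[[M fM] f0] /l1_null_predP[[N gN] g0]].
  apply/l1_null_predP; split=> [|n]; last exact: null_sum0.
  by exists 0 => B _; rewrite big1// => i _; rewrite normr0.
apply/l1_null_predP; split=> [|n]; last exact: null_sum_lin.
by exists (`|a| * M + N); exact/l1_leD/gN/l1_leZ.
Qed.

HB.instance Definition _ :=
  GRing.isSubmodClosed.Build _ _ l1_null_pred l1_null_submod_closed.

Record l1_null := L1Null { l1_val :> I -> R; _ : l1_val \in l1_null_pred }.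

HB.instance Definition _ := [isSub for l1_val].
HB.instance Definition _ := [Choice of l1_null by <:].
HB.instance Definition _ := [SubChoice_isSubLmodule of l1_null by <:].

Lemma l1_nullP (x : l1_null) : l1_fun x /\ forall n, null_sum (P n) x.
Proof. by case: x => x /= /l1_null_predP. Qed.

Lemma l1_null_norm_le (x : l1_null) M : l1norm x <= M <-> l1_le x M.
Proof.
split; last exact: l1norm_le.
by move=> xM; apply: l1_leW xM (l1_le_norm (proj1 (l1_nullP x))).
Qed.

Lemma l1_null_normD (x y : l1_null) : l1norm (x + y : l1_null) <= l1norm x + l1norm y.
Proof. by apply: l1norm_le; apply: l1_leD; exact/l1_null_norm_le. Qed.

Lemma l1_null_normZ a (x : l1_null) : l1norm (a *: x : l1_null) = `|a| * l1norm x.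
Proof.
have leZ b (y : l1_null) : l1norm (b *: y : l1_null) <= `|b| * l1norm y.
  by apply: l1norm_le; apply: l1_leZ; exact/l1_null_norm_le.
apply/eqP; rewrite eq_le leZ /=; have [->|a0] := eqVneq a 0.
  rewrite normr0 mul0r; apply: le_trans (_ : \sum_(i <- [::]) `|(0 *: x) i| <= _).
    by rewrite big_nil.
  exact: (l1_le_norm (proj1 (l1_nullP (0 *: x)))).
rewrite -ler_pdivlMl ?normr_gt0//.
by have := leZ a^-1 (a *: x); rewrite scalerA mulVf// scale1r normfV.
Qed.

Lemma l1_null_norm0_eq0 (x : l1_null) : l1norm x = 0 -> x = 0.
Proof.
move=> x0; apply: val_inj; apply/funext => i /=.
by apply: l1_le_eq0; apply/l1_null_norm_le; rewrite x0.
Qed.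

HB.instance Definition _ := Lmodule_isNormed.Build R l1_null
  l1_null_normD l1_null_normZ l1_null_norm0_eq0.

Lemma l1_null_le (x : l1_null) M : `|x| <= M <-> l1_le x M.
Proof. exact: l1_null_norm_le. Qed.

Lemma l1_null_approx (f : I -> R) :
  (forall e, 0 < e -> exists x : l1_null, l1_le (fun i => f i - x i) e) ->
  f \in l1_null_pred.
Proof.
move=> fapp; apply/l1_null_predP; split=> [|n].
  have [x fx] := fapp 1 ltr01; have [[M xM] _] := l1_nullP x.
  exists (1 + M); apply: l1_le_abs (l1_leD fx xM) => i.
  by rewrite subrK.
apply: null_sum_approx => e /fapp[x fx]; exists x => //.
exact: (proj2 (l1_nullP x)).
Qed.

(** A Cauchy filter converges at each coordinate; the bounds on finite partial
    sums pass to the pointwise limit, which is therefore a limit in norm. *)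
Lemma l1_null_cauchy_cvg (F : set_system l1_null) :
  ProperFilter F -> cauchy F -> cvg F.
Proof.
move=> FF cF.
have exF (e : R) : 0 < e -> exists x0 : l1_null, F (fun x => `|x0 - x| <= e).
  move=> e0; have /cauchyP/(_ e e0)[x0 x0e] := cF.
  by exists x0; apply: filterS x0e => x; rewrite -ball_normE; exact: ltW.
have coord_le (x y : l1_null) e i : `|x - y| <= e -> `|x i - y i| <= e.
  by move=> /l1_null_le /(_ [:: i] isT); rewrite big_seq1.
have /choice[f fF] : forall i, exists l : R, (fun x : l1_null => x i) @ F --> l.
  move=> i; apply/cvg_ex; apply: cauchy_cvg; apply/cauchyP => e e0.
  have [x0 Fx0] := exF _ (divr_gt0 e0 (ltr0n R 2)).
  exists (x0 i); suff : F [set x : l1_null | ball (x0 i) e (x i)] by [].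
  apply: (filterS _ Fx0) => x /(coord_le _ _ _ i) xi /=.
  by rewrite -ball_normE /=; apply: le_lt_trans xi _; lra.
have fle (e : R) (x0 : l1_null) : F (fun x => `|x0 - x| <= e) ->
    l1_le (fun i => f i - x0 i) e.
  move=> Fx0 B uB; apply: (@cvgr_to_le _ F _ _
    (fun x : l1_null => \sum_(i <- B) `|x i - x0 i|)).
    apply: cvg_big => [|i _]; first exact: add_continuous.
    by apply: cvg_norm; apply: cvgB; [exact: fF | exact: cvg_cst].
  apply: filterS Fx0 => x; rewrite distrC => /l1_null_le; exact.
have fP : f \in l1_null_pred.
  by apply: l1_null_approx => e /exF[x0 /fle]; exists x0.
apply/cvg_ex; exists (L1Null fP); apply/cvgrPdist_le => e e0.
have [x0 Fx0] := exF _ (divr_gt0 e0 (ltr0n R 2)).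
apply: filterS (Fx0) => x x0x; rewrite -(subrK x0 (L1Null fP)) -addrA [e]splitr.
rewrite (le_trans (ler_normD _ _))// lerD//.
by apply/l1_null_le; exact: fle.
Qed.

HB.instance Definition _ := Uniform_isComplete.Build l1_null l1_null_cauchy_cvg.

(** Encoded by a pair of lists, so that the encodings form a countable type. *)
Definition rational_step (q : seq I * seq rat) (i : I) : R :=
  if i \in q.1 then ratr (nth 0 q.2 (index i q.1)) else 0.

Lemma rational_step_dense (f : I -> R) e : l1_fun f -> 0 < e ->
  exists q, l1_le (fun i => f i - rational_step q i) e.
Proof.
move=> ff e0; have e20 : 0 < e / 2 by rewrite divr_gt0.
have [K uK fK] := l1_tail ff e20.
pose d := e / 2 / (size K).+1%:R.
have d0 : 0 < d by rewrite divr_gt0.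
have /choice[r rP] : forall i, exists r : rat, `|f i - ratr r| <= d.
  move=> i; have [|r] := @rat_in_itvoo R (f i - d) (f i + d); first by lra.
  rewrite in_itv/= => /andP[r1 r2]; exists r; rewrite ler_norml; lra.
exists (K, map r K) => B uB.
rewrite (bigID (mem K))/= [e]splitr lerD//; last first.
  rewrite (eq_bigr (fun i => `|f i|)); last first.
    by move=> i /negPf iK; rewrite /rational_step/= iK subr0.
  rewrite -big_filter; apply: fK; first exact: filter_uniq.
  by move=> i; rewrite mem_filter => /andP[].
apply: (@le_trans _ _ (\sum_(i <- B | i \in K) d)).
  apply: ler_sum => i iK; rewrite /rational_step/= iK.
  by rewrite (nth_map i) ?index_mem// nth_index.
rewrite -big_filter big_const_seq count_predT iter_addr_0.
have -> : e / 2 = d * (size K).+1%:R by rewrite /d divfK.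
rewrite -[leLHS]mulr_natr ler_wpM2l ?(ltW d0)// ler_nat; apply: leqW.
apply: uniq_leq_size; first exact: filter_uniq.
by move=> i; rewrite mem_filter => /andP[].
Qed.

(** The rational step functions need not have vanishing block sums, so they
    are only used as centres of countably many balls, and one point of the
    space is picked in each of those that meet it. *)
Lemma l1_null_separable : separable l1_null.
Proof.
pose near_step (qk : (seq I * seq rat) * nat) (x : l1_null) :=
  l1_le (fun i => x i - rational_step qk.1 i) (qk.2.+1%:R^-1).
have /choice[p pP] : forall qk, exists x, (exists y, near_step qk y) -> near_step qk x.
  move=> qk; have [[y yP]|n] := pselect (exists y, near_step qk y); first by exists y.
  by exists 0.
exists (range p).
  exact: card_le_trans (card_image_le _ _) (countableP _).
move=> U [x Ux] oU.
have /nbhs_ballP[e /= e0 xeU] : nbhs x U by exact: open_nbhs_nbhs.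
have [k ke] : exists k, 2 * k.+1%:R^-1 < e.
  have e20 : 0 < e / 2 by rewrite divr_gt0.
  have [k _ /(_ k (leqnn k))/= ke] := near_infty_natSinv_lt (PosNum e20).
  by exists k; rewrite mulrC -ltr_pdivlMr.
have k0 : 0 < k.+1%:R^-1 :> R by [].
have [q qP] := rational_step_dense (proj1 (l1_nullP x)) k0.
exists (p (q, k)); split; last by exists (q, k).
apply: xeU; rewrite -ball_normE; apply: le_lt_trans ke.
have pq : near_step (q, k) (p (q, k)) by apply: pP; exists x.
apply/l1_null_le; rewrite mulr_natl mulr2n.
apply: l1_le_abs (l1_leB qP pq) => i.
by rewrite opprB addrA subrK lexx.
Qed.

End Space.

(** * The affine action *)

Section AffineAction.
Variable R : realType.

Definition block (n : nat) : pred (seq nat) := fun s => uniq s && (size s == n).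

Notation X := (l1_null R block).

(** One point mass in each block; it belongs to the ambient space of summable
    functions, but not to [X]. *)
Definition base (s : seq nat) : R :=
  if s == iota 0 (size s) then 2^-1 ^+ size s else 0.

Lemma base_ge0 s : 0 <= base s.
Proof. by rewrite /base; case: ifP => // _; rewrite exprn_ge0. Qed.

Lemma sum_half_pow_le2 (L : seq nat) : uniq L ->
  \sum_(k <- L) 2^-1 ^+ k <= 2 :> R.
Proof.
move=> uL; pose n := (\max_(k <- L) k).+1.
apply: (@le_trans _ _ (\sum_(k <- iota 0 n) 2^-1 ^+ k)).
  rewrite [leRHS](bigID (mem L)) -[leLHS]addr0.
  apply: lerD; last by apply: sumr_ge0 => k _; rewrite exprn_ge0.
  rewrite -big_filter [leRHS](perm_big L) ?lexx//.
  apply: uniq_perm => [||k]; [by rewrite filter_uniq// iota_uniq | exact: uL |].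
  rewrite mem_filter mem_iota add0n ltnS /=.
  by case kL: (k \in L) => //=; exact: (@leq_bigmax_seq _ L xpredT id k).
suff -> : \sum_(k <- iota 0 n) 2^-1 ^+ k = 2 - 2 * 2^-1 ^+ n :> R.
  by rewrite lerBlDr lerDl mulr_ge0// exprn_ge0.
elim: n => [|n IH]; first by rewrite big_nil expr0; lra.
by rewrite -addn1 iotaD big_cat IH big_seq1/= add0n addn1 exprS; lra.
Qed.

Lemma base_l1 : l1_fun base.
Proof.
exists 2 => B uB; under eq_bigr do rewrite ger0_norm ?base_ge0//.
rewrite /base -big_mkcond/= -big_filter -(big_map size xpredT (fun k => 2^-1 ^+ k)).
apply: sum_half_pow_le2; rewrite map_inj_in_uniq ?filter_uniq// => s t.
rewrite !mem_filter => /andP[/eqP se _] /andP[/eqP te _] st.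
by rewrite se te st.
Qed.

Lemma base_block_sum n (B : seq (seq nat)) : uniq B -> iota 0 n \in B ->
  \sum_(s <- B | block n s) base s = 2^-1 ^+ n.
Proof.
move=> uB nB; rewrite -big_filter (bigD1_seq (iota 0 n)) ?filter_uniq//=; last first.
  by rewrite mem_filter nB /block iota_uniq size_iota eqxx.
rewrite big_seq_cond big1 ?addr0 /base ?size_iota ?eqxx// => s.
by rewrite mem_filter => /andP[/andP[/andP[_ /eqP ->] _] /negPf ->].
Qed.

Definition translate (g : Sinf) (f : seq nat -> R) s := f (map g^-1%g s).

Lemma mapSK (g : Sinf) : cancel (map g) (map g^-1%g).
Proof. exact: mapK (sfunK g). Qed.

Lemma mapSVK (g : Sinf) : cancel (map g^-1%g) (map g).
Proof. exact: mapK (sfunVK g). Qed.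

Lemma block_map n (g : Sinf) s : block n (map g s) = block n s.
Proof. by rewrite /block size_map map_inj_uniq//; exact: Sinf_inj. Qed.

Lemma l1_le_translate g f M : l1_le f M -> l1_le (translate g f) M.
Proof. exact: l1_le_comp (can_inj (mapSVK g)). Qed.

(** The translates of [base] carry the same mass in each block, so that their
    differences lie in [X]. *)
Lemma base_translate_null n g : null_sum (block n) (fun s => translate g base s - base s).
Proof.
move=> e e0; exists [:: iota 0 n; map g (iota 0 n)] => B uB AB.
rewrite sumrB base_block_sum ?AB ?mem_head//.
have -> : \sum_(s <- B | block n s) translate g base s =
    \sum_(s <- map (map g^-1%g) B | block n s) base s.
  by rewrite big_map; apply: eq_bigl => s; rewrite block_map.
rewrite base_block_sum ?subrr ?normr0 ?ltW//.
  by rewrite map_inj_uniq//; exact: can_inj (mapSVK g).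
by rewrite -[iota 0 n](mapSK g) map_f// AB// !inE eqxx orbT.
Qed.

(** The point of the affine space [base + X] represented by [x]. *)
Definition mass (x : X) (s : seq nat) : R := x s + base s.

Lemma translate_mass_l1_null g x : (fun s => translate g (mass x) s - base s) \in
  @l1_null_pred R _ block.
Proof.
have [[M xM] x0] := l1_nullP x; have [N bN] := base_l1.
apply/l1_null_predP; split=> [|n].
  by exists (M + N + N); exact: l1_leB (l1_le_translate g (l1_leD xM bN)) bN.
have xg : null_sum (block n) (translate g x).
  by apply: (null_sum_comp (mapSVK g) (mapSK g)) => // s; rewrite block_map.
have := null_sum_lin 1 xg (base_translate_null n g).
by congr null_sum; apply/funext => s; rewrite mul1r addrA.
Qed.

(** The translation action on the affine space [base + X], with [base] taken
    as origin. *)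
Definition act g x : X := L1Null (translate_mass_l1_null g x).

Lemma mass_act g x s : mass (act g x) s = mass x (map g^-1%g s).
Proof. by rewrite /mass /= subrK. Qed.

Lemma mass_inj x y : mass x =1 mass y -> x = y.
Proof. by move=> xy; apply/val_inj/funext => s; apply: (addIr (base s)); exact: xy. Qed.

Lemma norm_mass x y M : `|x - y| <= M <-> l1_le (fun s => mass x s - mass y s) M.
Proof.
rewrite l1_null_le.
suff -> : (x - y : X) = (fun s => mass x s - mass y s) :> (seq nat -> R) by [].
by apply/funext => s; rewrite /mass opprD addrACA subrr addr0.
Qed.

Lemma act1 x : act 1%g x = x.
Proof. by apply: mass_inj => s; rewrite mass_act map_id. Qed.

Lemma actM g h x : act (g * h)%g x = act g (act h x).
Proof. by apply: mass_inj => s; rewrite !mass_act -map_comp. Qed.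

Lemma act_affine g : affine_map (act g).
Proof.
move=> t x y; apply: mass_inj => s; rewrite mass_act /mass.
have lin z w u : (t *: z + (1 - t) *: w : X) u = t * z u + (1 - t) * w u by [].
by rewrite !lin /= /translate /mass; ring.
Qed.

Lemma act_isometric g : isometric_map (act g).
Proof.
have nonexp h x y : `|act h x - act h y| <= `|x - y|.
  apply/norm_mass => B uB; under eq_bigr do rewrite !mass_act.
  exact: (l1_le_translate h ((norm_mass x y _).1 (lexx _)) uB).
move=> x y; apply/eqP; rewrite eq_le nonexp /=.
have := nonexp g^-1%g (act g x) (act g y).
by rewrite -!actM mulVg !act1.
Qed.

(** Up to a small tail, the mass of [x] sits on finitely many tuples, where
    [g] and [h] act alike. *)
Lemma act_near (x : X) e : 0 < e -> exists K : seq (seq nat), forall g h : Sinf,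
  {in K, map g =1 map h} -> `|act g x - act h x| <= e.
Proof.
move=> e0; have e20 : 0 < e / 2 by rewrite divr_gt0.
have [[M xM] _] := l1_nullP x; have [N bN] := base_l1.
have mx : l1_fun (mass x) by exists (M + N); exact: l1_leD.
have [K _ xK] := l1_tail mx e20; exists K => g h gh.
apply/norm_mass => B uB; under eq_bigr do rewrite !mass_act.
have gK s : map g^-1%g s \in K -> map h^-1%g s = map g^-1%g s.
  by move=> sK; rewrite -{1}[s](mapSVK g) gh// mapSK.
have hK s : map h^-1%g s \in K -> map g^-1%g s = map h^-1%g s.
  by move=> sK; rewrite -{1}[s](mapSVK h) -gh// mapSK.
pose B' := [seq s <- B | map g^-1%g s \notin K].
have tail (k : Sinf) : {in B', forall s, map k^-1%g s \notin K} ->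
    \sum_(s <- B') `|mass x (map k^-1%g s)| <= e / 2.
  move=> kB'; rewrite -(big_map (map k^-1%g) xpredT (fun s => `|mass x s|)).
  apply: xK; first by rewrite map_inj_uniq ?filter_uniq//; exact: can_inj (mapSVK k).
  by move=> _ /mapP[s /kB' sK ->].
rewrite (bigID (fun s => map g^-1%g s \in K))/= big1 ?add0r; last first.
  by move=> s /gK ->; rewrite subrr normr0.
rewrite -big_filter -/B' [leRHS]splitr.
apply: le_trans (lerD (tail g _) (tail h _)).
- by rewrite -big_split/=; apply: ler_sum => s _; exact: ler_normB.
- by move=> s; rewrite mem_filter => /andP[].
- move=> s; rewrite mem_filter => /andP[+ _].
  by apply: contra => sK; rewrite hK.
Qed.

Lemma act_continuous : continuous (fun p : Sinf * X => act p.1 p.2).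
Proof.
move=> [g x]; apply/cvgrPdist_le => e e0.
have e20 : 0 < e / 2 by rewrite divr_gt0.
have [K gK] := act_near x e20.
pose U := [set h : Sinf | {in K, map g =1 map h}].
pose V := [set y : X | `|x - y| <= e / 2].
have gU : nbhs g U.
  apply/nbhs_Sinf; exists (\max_(i <- flatten K) i).+1 => h hg s sK.
  apply/eq_in_map => i si; rewrite hg// ltnS.
  by apply: (@leq_bigmax_seq _ _ xpredT id i) => //; apply/flattenP; exists s.
have xV : nbhs x V.
  by apply/nbhs_ballP; exists (e / 2) => //= y; rewrite -ball_normE; exact: ltW.
exists (U, V) => // -[h y] [/= hU yV].
rewrite -(subrK (act h x) (act g x)) -addrA [e]splitr.
apply: le_trans (ler_normD _ _) _; apply: lerD; first exact: gK.
by rewrite act_isometric; exact: yV.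
Qed.

(** * Compact sets and finite sets of tuples *)

Lemma compact_net (C : set X) e : compact C -> 0 < e ->
  exists L : seq X, forall x, C x -> exists2 c, c \in L & `|x - c| <= e.
Proof.
rewrite compact_cover => cC e0.
have [|x Cx|L _ CL] := cC X setT (fun c => ball c e).
- by move=> c _; exact: ball_open.
- by exists x => //; exact: ballxx.
- exists (finmap.enum_fset L) => x /CL[c cL xc]; exists c => //.
  by move: xc; rewrite -ball_normE /= distrC; exact: ltW.
Qed.

(** It suffices to treat the finitely many centres [c] of a [d]-net of [C]:
    [K] contains, for each [c], a set supporting all but [d] of the mass and a
    set beyond which the partial sums of [c] over the block are at most
    [d], so that those of [mass c] are close to the sum [2^-n] of [base]. *)
Lemma compact_block_mass (C : set X) n d : compact C -> 0 < d ->
  exists K : seq (seq nat), [/\ uniq K, {in K, forall s, block n s},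
    forall x, C x -> 2^-1 ^+ n - 2 * d <= \sum_(s <- K) `|mass x s| &
    forall x B, C x -> uniq B -> {in B, forall s, block n s} ->
      {in B, forall s, s \notin K} -> \sum_(s <- B) `|mass x s| <= 2 * d].
Proof.
move=> cC d0; have [L CL] := compact_net cC d0.
have /choice[T TP] : forall c : X, exists T : seq (seq nat),
    forall B, uniq B -> {in B, forall s, s \notin T} ->
    \sum_(s <- B) `|mass c s| <= d.
  move=> c; have [[M cM] _] := l1_nullP c; have [N bN] := base_l1.
  have mc : l1_fun (mass c) by exists (M + N); exact: l1_leD.
  by have [T _ TP] := l1_tail mc d0; exists T.
have /choice[A AP] : forall c : X, exists A : seq (seq nat),
    forall B, uniq B -> {subset A <= B} -> `|\sum_(s <- B | block n s) c s| <= d.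
  by move=> c; exact: (proj2 (l1_nullP c) n d d0).
pose K' := undup (iota 0 n :: flatten (map T L) ++ flatten (map A L)).
have TK' c s : c \in L -> s \in T c -> s \in K'.
  move=> cL sT; rewrite mem_undup inE mem_cat; apply/orP; right; apply/orP; left.
  by apply/flattenP; exists (T c) => //; exact: map_f.
have AK' c s : c \in L -> s \in A c -> s \in K'.
  move=> cL sA; rewrite mem_undup inE mem_cat; apply/orP; right; apply/orP; right.
  by apply/flattenP; exists (A c) => //; exact: map_f.
exists [seq s <- K' | block n s]; split.
- by rewrite filter_uniq ?undup_uniq.
- by move=> s; rewrite mem_filter => /andP[].
- move=> x Cx; have [c cL xc] := CL x Cx.
  apply: le_trans (ler_norm_sum _ _ _); rewrite big_filter.
  have -> : \sum_(s <- K' | block n s) mass x s =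
      \sum_(s <- K' | block n s) (x - c) s +
      (\sum_(s <- K' | block n s) c s + \sum_(s <- K' | block n s) base s).
    rewrite -!big_split/=; apply: eq_bigr => s _.
    by rewrite addrA; congr (_ + _); rewrite subrK.
  rewrite base_block_sum ?undup_uniq ?mem_undup ?mem_head//.
  have Ac : `|\sum_(s <- K' | block n s) c s| <= d.
    by apply: AP; [exact: undup_uniq | move=> s; exact: AK'].
  have xcK : `|\sum_(s <- K' | block n s) (x - c) s| <= d.
    rewrite -big_filter (le_trans (ler_norm_sum _ _ _))//.
    by move/l1_null_le: xc; apply; rewrite filter_uniq ?undup_uniq.
  move: Ac xcK; rewrite !ler_norml => /andP[? ?] /andP[? ?].
  by apply: le_trans (ler_norm _); lra.
- move=> x B Cx uB Bn BK; have [c cL xc] := CL x Cx.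
  have cB : \sum_(s <- B) `|mass c s| <= d.
    apply: TP => // s sB; apply: contra (BK s sB) => sT.
    by rewrite mem_filter Bn// (TK' c).
  have xcB := (norm_mass x c d).1 xc B uB.
  rewrite mulr_natl mulr2n; apply: le_trans (lerD xcB cB).
  rewrite -big_split/=; apply: ler_sum => s _.
  by rewrite -{1}[mass x s](subrK (mass c s)) ler_normD.
Qed.

(** If [g] moves [K] off itself, then the mass of [act g x] on the translate
    of [K] is at least [2^-n - 2 d], while that of [y] is at most [2 d]; the
    choice of [d] turns the difference [2^-n - 4 d] into half of [2^-n]. *)
Lemma compact_displacement (C : set X) n : compact C ->
  exists K : seq (seq nat), {in K, forall s, block n s} /\
    forall g : Sinf, {in K &, forall a b, map g a <> b} ->
    forall x y, C x -> C y -> 2^-1 ^+ n / 2 <= `|act g x - y|.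
Proof.
move=> cC; pose d : R := 2^-1 ^+ n / 8.
have d0 : 0 < d by rewrite divr_gt0// exprn_gt0.
have [K [uK Kn Kmass Ktail]] := compact_block_mass n cC d0.
exists K; split=> // g gK x y Cx Cy.
have ugK : uniq (map (map g) K) by rewrite map_inj_uniq//; exact: can_inj (mapSK g).
have lowx := Kmass x Cx.
have lowy : \sum_(s <- map (map g) K) `|mass y s| <= 2 * d.
  apply: Ktail => // _ /mapP[s sK ->]; first by rewrite block_map Kn.
  by apply/negP => gsK; exact: gK sK gsK erefl.
have := (norm_mass (act g x) y _).1 (lexx _) _ ugK.
apply: le_trans.
apply: (@le_trans _ _ (\sum_(s <- K) `|mass x s| -
    \sum_(s <- map (map g) K) `|mass y s|)); first by rewrite /d in lowx lowy; lra.
rewrite !big_map -sumrB; apply: ler_sum => s _.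
by rewrite mass_act mapSK; exact: lerB_dist.
Qed.

End AffineAction.

(** * Neighbourhoods of the identity and displacement of compact sets *)

Lemma stabilisers_nested_nbhs_basis (G : set Sinf) n0 :
  nested_nbhs_basis1 G (fun n => stabiliser G (iota 0 (n0 + n))).
Proof.
split=> [n g []//|n g [Gg gn]|n|U].
- split=> // x; rewrite mem_iota => /andP[_ xn]; apply: gn.
  by rewrite mem_iota /= addnS ltnS ltnW.
- apply/nbhs_Sinf; exists (n0 + n)%N => g g1 Gg; split=> // x.
  by rewrite mem_iota => /andP[_ /g1].
- move=> /nbhs_Sinf[n nU]; exists n => g [Gg gn]; apply: nU => // i ni.
  by rewrite gn// mem_iota add0n ltn_addl.
Qed.

Theorem theorem1p6 (R : realType) (G : set Sinf) (grpG : group_closed (mem G))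
    (clG : closed G) (oligoG : oligomorphic G) :
  (exists V : nat -> set Sinf, nested_nbhs_basis1 G V /\
    forall F E : nat -> set Sinf,
      (forall n, finite_set (F n) /\ F n `<=` G) ->
      (forall n, finite_set (E n) /\ E n `<=` G) ->
      G <> \bigcup_n set_mulg (set_mulg (F n) (V n)) (E n))
  /\
  (exists (X : completeNormedModType R) (act : Sinf -> X -> X),
    separable X /\ continuous_affine_isometric_action G act /\
    exists eps : nat -> R, (forall n, 0 < eps n) /\
      forall C : nat -> set X, (forall n, compact (C n)) ->
        exists2 g, G g &
          forall n, ((eps n)%:E < set_dist (act g @` C n) (C n))%E).
Proof.
have [n0 avoid] := avoid_pairs (is_subgroup_group_closed grpG) oligoG clG.
split.
  exists (fun n => stabiliser G (iota 0 (n0 + n))).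
  split; first exact: stabilisers_nested_nbhs_basis.
  move=> F E finF finE GFE.
  have /choice[LF LFP] n : exists s : seq Sinf, F n = [set` s].
    by apply/finite_seqP; case: (finF n).
  have /choice[LE LEP] n : exists s : seq Sinf, E n = [set` s].
    by apply/finite_seqP; case: (finE n).
  have uniq_map_iota (k : Sinf) n : uniq (map k (iota 0 n)).
    by rewrite map_inj_uniq ?iota_uniq//; exact: Sinf_inj.
  (* A product [f v e] with [v] fixing a tuple maps the preimage of that tuple
     by [e] to its image by [f]. *)
  have [n _ /allpairsP[[e f] /= [_ _ ->]]|g Gg gS] := avoid (fun n =>
    [seq (map e^-1%g (iota 0 (n0 + n)), map f (iota 0 (n0 + n))) |
      e : Sinf <- LE n, f : Sinf <- LF n]).
    by split; rewrite /= ?size_map ?size_iota//;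
      exact: (uniq_map_iota e^-1%g).
  have [n _ [_ [f Ff [v [_ vn] <-]] [e Ee gE]]] :
      (\bigcup_n set_mulg (set_mulg (F n) (stabiliser G (iota 0 (n0 + n)))) (E n)) g.
    by rewrite -GFE.
  rewrite LFP in Ff; rewrite LEP in Ee.
  apply: (gS n (map e^-1%g (iota 0 (n0 + n)), map f (iota 0 (n0 + n)))).
    by apply/allpairsP; exists (e, f).
  rewrite -map_comp -gE; apply/eq_in_map => i /vn vi.
  exact: etrans (congr1 (fun z => f (v z)) (SinfVK e i)) (congr1 f vi).
exists (l1_null R block), (@act R); split; first exact: l1_null_separable.
split.
  split; first by split=> [x|g h _ _ x]; [exact: act1 | exact: actM].
  - exact/continuous_subspaceT/act_continuous.
  - by move=> g _; exact: act_affine.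
  - by move=> g _; exact: act_isometric.
exists (fun n => 2^-1 ^+ (n0 + n) / 4); split=> [n|C cC].
  by rewrite divr_gt0// exprn_gt0.
have /choice[K KP] n := compact_displacement (n0 + n) (cC n).
have [n _ /allpairsP[[a b] /= [aK bK ->]]|g Gg gK] :=
  avoid (fun n => [seq (a, b) | a <- K n, b <- K n]).
  by have [Kn _] := KP n; move: (Kn a aK) (Kn b bK) => /andP[ua /eqP ->] /andP[ub /eqP ->].
exists g => // n; have [_ moved] := KP n.
have gKn : {in K n &, forall a b, map g a <> b}.
  by move=> a b aK bK; apply: (gK n (a, b)); apply/allpairsP; exists (a, b).
have pow0 : 0 < 2^-1 ^+ (n0 + n) :> R by rewrite exprn_gt0.
apply: (@lt_le_trans _ _ (2^-1 ^+ (n0 + n) / 2)%:E).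
  by rewrite lte_fin; lra.
apply/ereal_infP => _ [_ [x Cx <-] [y Cy <-]]; rewrite lee_fin.
exact: moved.
Qed.
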